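(* Let $\Bbbk$ be a field, $A$ a finite-dimensional $\Bbbk$-algebra, and $G$ a finite group acting on $A$ by $\Bbbk$-algebra automorphisms. If $\mathrm{char}(\Bbbk)$ does not divide the order of $G$, then $A$ and the skew group algebra $A\ast G$ are symmetrically separably equivalent.
   Context: All algebras are finite-dimensional, associative, unital $\Bbbk$-algebras, and all (bi)modules are finite-dimensional. The skew group algebra $A\ast G$ is the vector space $A\otimes_\Bbbk \Bbbk G$ with multiplication $(a\otimes g)(a'\otimes g')=a\,g(a')\otimes gg'$. A bimodule ${}_AM_B$ is left-right projective if ${}_AM$ is a projective left $A$-module and $M_B$ is a projective right $B$-module. Algebras $A$ and $B$ are symmetrically separably equivalent if there are left-right projective bimodules ${}_AM_B$ and ${}_BN_A$ such that $A$ is a direct summand of $M\otimes_B N$ as $A$-$A$-bimodule, $B$ is a direct summand of $N\otimes_A M$ as $B$-$B$-bimodule, and the functors $M\otimes_B-:B\text{-mod}\to A\text{-mod}$ and $N\otimes_A-:A\text{-mod}\to B\text{-mod}$ are biadjoint (each is both left and right adjoint to the other). *)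

(* Defs.v *)
From HB Require Import structures.
From mathcomp Require Import all_boot all_fingroup all_algebra all_field.
From mathcomp Require Import boolp.

Set Implicit Arguments.
Unset Strict Implicit.
Unset Printing Implicit Defensive.

Import GRing.Theory VectorInternalTheory.
Local Open Scope ring_scope.

#[local] Obligation Tactic := idtac.

Section Bimodules.

Variable k : fieldType.

(* The field k acts centrally: both actions are k-bilinear for the same
   k-vector space structure. *)
Record bimodule (A B : falgType k) := Bimodule {
  bimod_sort :> vectType k;
  lact : A -> bimod_sort -> bimod_sort;
  ract : bimod_sort -> B -> bimod_sort;
  lact_linear : forall a, linear (lact a);
  lact_linearl : forall x, linear (lact^~ x);
  lact1 : forall x, lact 1 x = x;
  lactM : forall a a' x, lact (a * a') x = lact a (lact a' x);
  ract_linear : forall b, linear (ract^~ b);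
  ract_linearr : forall x, linear (ract x);
  ract1 : forall x, ract x 1 = x;
  ractM : forall b b' x, ract x (b * b') = ract (ract x b) b';
  lractA : forall a b x, lact a (ract x b) = ract (lact a x) b }.

(* As k acts centrally, an A-k-bimodule carries no more data than a left
   A-module, and a k-B-bimodule no more than a right B-module. *)
Definition lmodule (A : falgType k) := bimodule A k^o.
Definition rmodule (B : falgType k) := bimodule k^o B.

Section ActionLinear.

Variables (A B : falgType k) (M : bimodule A B).

HB.instance Definition _ a := GRing.isLinear.Build k M M *:%R (lact a) (lact_linear a).

Definition ractr b (x : M) := ract x b.

HB.instance Definition _ b :=
  GRing.isLinear.Build k M M *:%R (ractr b) (ract_linear b).

End ActionLinear.

Section Hom.

Variables A B : falgType k.

Record bimod_hom (M N : bimodule A B) := BimodHom {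
  bimod_hom_fun :> 'Hom(M, N);
  bimod_hom_lact : forall a x, bimod_hom_fun (lact a x) = lact a (bimod_hom_fun x);
  bimod_hom_ract : forall b x, bimod_hom_fun (ract x b) = ract (bimod_hom_fun x) b }.

Lemma bimod_homP (M N : bimodule A B) (f g : bimod_hom M N) : f =1 g -> f = g.
Proof.
case: f g => [f fl fr] [g gl gr] /= /lfunP fg; case: _ / fg in gl gr *.
by rewrite (Prop_irrelevance fl gl) (Prop_irrelevance fr gr).
Qed.

Program Definition bimod_id (M : bimodule A B) : bimod_hom M M :=
  @BimodHom M M \1%VF _ _.
Next Obligation. by move=> M a x; rewrite !id_lfunE. Qed.
Next Obligation. by move=> M b x; rewrite !id_lfunE. Qed.

Program Definition bimod_comp (M N P : bimodule A B)
    (g : bimod_hom N P) (f : bimod_hom M N) : bimod_hom M P :=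
  @BimodHom M P (g \o f)%VF _ _.
Next Obligation. by move=> M N P g f a x; rewrite !comp_lfunE !bimod_hom_lact. Qed.
Next Obligation. by move=> M N P g f b x; rewrite !comp_lfunE !bimod_hom_ract. Qed.

Definition bimod_iso (M N : bimodule A B) : Prop :=
  exists f : bimod_hom M N, bijective f.

Program Definition bimod_sum (M N : bimodule A B) : bimodule A B :=
  @Bimodule A B (M * N)%type
    (fun a x => (lact a x.1, lact a x.2)) (fun x b => (ract x.1 b, ract x.2 b))
    _ _ _ _ _ _ _ _ _.
Next Obligation. by move=> M N a c [? ?] [? ?] /=; rewrite !lact_linear. Qed.
Next Obligation. by move=> M N x c a a' /=; rewrite !lact_linearl. Qed.
Next Obligation. by move=> M N [x y] /=; rewrite !lact1. Qed.
Next Obligation. by move=> M N a a' x /=; rewrite !lactM. Qed.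
Next Obligation. by move=> M N b c [? ?] [? ?] /=; rewrite !ract_linear. Qed.
Next Obligation. by move=> M N x c b b' /=; rewrite !ract_linearr. Qed.
Next Obligation. by move=> M N [x y] /=; rewrite !ract1. Qed.
Next Obligation. by move=> M N b b' x /=; rewrite !ractM. Qed.
Next Obligation. by move=> M N a b x /=; rewrite !lractA. Qed.

Definition direct_summand (M P : bimodule A B) : Prop :=
  exists N : bimodule A B, bimod_iso (bimod_sum M N) P.

(* Only used at P : lmodule A and P : rmodule B. *)
Definition projective (P : bimodule A B) : Prop :=
  forall (X Y : bimodule A B) (p : bimod_hom X Y) (f : bimod_hom P Y),
    (forall y, exists x, p x = y) ->
    exists g : bimod_hom P X, bimod_comp p g = f.

Program Definition left_module (M : bimodule A B) : lmodule A :=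
  @Bimodule A k^o M (@lact _ _ M) (fun x c => c *: x) _ _ _ _ _ _ _ _ _.
Next Obligation. by move=> M; apply: lact_linear. Qed.
Next Obligation. by move=> M; apply: lact_linearl. Qed.
Next Obligation. by move=> M; apply: lact1. Qed.
Next Obligation. by move=> M; apply: lactM. Qed.
Next Obligation. by move=> M b c x y; rewrite scalerDr !scalerA mulrC. Qed.
Next Obligation. by move=> M x c b b'; rewrite scalerDl scalerA. Qed.
Next Obligation. by move=> M x; apply: scale1r. Qed.
Next Obligation. by move=> M b b' x; rewrite [RHS]scalerA mulrC. Qed.
Next Obligation. by move=> M a b x; rewrite linearZ. Qed.

Program Definition right_module (M : bimodule A B) : rmodule B :=
  @Bimodule k^o B M (fun c x => c *: x) (@ract _ _ M) _ _ _ _ _ _ _ _ _.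
Next Obligation. by move=> M b c x y; rewrite scalerDr !scalerA mulrC. Qed.
Next Obligation. by move=> M x c b b'; rewrite scalerDl scalerA. Qed.
Next Obligation. by move=> M x; apply: scale1r. Qed.
Next Obligation. by move=> M a a' x; rewrite [RHS]scalerA. Qed.
Next Obligation. by move=> M; apply: ract_linear. Qed.
Next Obligation. by move=> M; apply: ract_linearr. Qed.
Next Obligation. by move=> M; apply: ract1. Qed.
Next Obligation. by move=> M; apply: ractM. Qed.
Next Obligation. by move=> M a b x; rewrite -[RHS]/(ractr b (a *: x)) linearZ. Qed.

End Hom.

Program Definition regular_bimodule (A : falgType k) : bimodule A A :=
  @Bimodule A A A *%R *%R _ _ _ _ _ _ _ _ _.
Next Obligation. by move=> A a c x y; rewrite mulrDr scalerAr. Qed.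
Next Obligation. by move=> A x c a b; rewrite mulrDl scalerAl. Qed.
Next Obligation. by move=> A; apply: mul1r. Qed.
Next Obligation. by move=> A a b x; rewrite mulrA. Qed.
Next Obligation. by move=> A a c x y; rewrite mulrDl scalerAl. Qed.
Next Obligation. by move=> A x c a b; rewrite mulrDr scalerAr. Qed.
Next Obligation. by move=> A; apply: mulr1. Qed.
Next Obligation. by move=> A a b x; rewrite mulrA. Qed.
Next Obligation. by move=> A a b x; rewrite mulrA. Qed.

End Bimodules.

Section Tensor.

Variables (k : fieldType) (A B C : falgType k).

Section Space.

Variables (M : bimodule A B) (N : bimodule B C).

Definition basis_vect (V : vectType k) (i : 'I_(dim V)) : V := r2v (delta_mx 0 i).

(* The space of matrices 'M_(dim M, dim N) stands for M (x)_k N, through the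
   coordinates in the standard bases of M and N. *)
Definition pure_k (m : M) (n : N) : 'M[k]_(dim M, dim N) := (v2r m)^T *m v2r n.

Definition tensor_relation (m : M) (b : B) (n : N) : 'M[k]_(dim M, dim N) :=
  pure_k (ract m b) n - pure_k m (lact b n).

(* By trilinearity it is enough to let m, b and n run through bases, see
   tensor_relation_mem. *)
Definition tensor_relations : {vspace 'M[k]_(dim M, dim N)} :=
  (\sum_i \sum_j \sum_l
     <[tensor_relation (basis_vect i) (basis_vect j) (basis_vect l)]>)%VS.

(* The quotient of M (x)_k N by the relations, realized on a complement. *)
Definition tensor_space : vectType k := subvs_of (tensor_relations^C)%VS.

Definition tensor_proj (w : 'M[k]_(dim M, dim N)) : tensor_space :=
  vsproj _ (daddv_pi (tensor_relations^C)%VS tensor_relations w).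

Definition pure (m : M) (n : N) : tensor_space := tensor_proj (pure_k m n).

(* The linear map on M (x)_B N with value f m n at pure m n, for f bilinear and
   B-balanced, see tensor_liftE. *)
Definition tensor_lift (V : vectType k) (f : M -> N -> V) (t : tensor_space) : V :=
  \sum_i \sum_j vsval t i j *: f (basis_vect i) (basis_vect j).

Lemma tensor_lift_linear (V : vectType k) (f : M -> N -> V) :
  linear (tensor_lift f).
Proof.
move=> c t u; rewrite /tensor_lift scaler_sumr -big_split; apply: eq_bigr => i _.
rewrite scaler_sumr -big_split; apply: eq_bigr => j _.
by rewrite linearP !mxE scalerDl scalerA.
Qed.

HB.instance Definition _ (V : vectType k) (f : M -> N -> V) :=
  GRing.isLinear.Build k tensor_space V *:%R (tensor_lift f) (tensor_lift_linear f).

Lemma tensor_proj_linear : linear tensor_proj.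
Proof. by move=> c x y; rewrite /tensor_proj !linearP. Qed.

HB.instance Definition _ :=
  GRing.isLinear.Build k 'M[k]_(dim M, dim N) tensor_space *:%R tensor_proj
    tensor_proj_linear.

Lemma basis_vectE (V : vectType k) (v : V) : v = \sum_i v2r v 0 i *: basis_vect i.
Proof.
apply: v2r_inj; rewrite linear_sum [LHS]row_sum_delta; apply: eq_bigr => i _.
by rewrite linearZ /= r2vK.
Qed.

Lemma pure_k_linearl n : linear (pure_k^~ n).
Proof. by move=> c x y; rewrite /pure_k !linearP mulmxDl -scalemxAl. Qed.

Lemma pure_k_linearr m : linear (pure_k m).
Proof. by move=> c x y; rewrite /pure_k !linearP. Qed.

Lemma trilinear_mem (U : vectType k) (R : {vspace U}) (X Y Z : vectType k)
    (f : X -> Y -> Z -> U) :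
  (forall y z, linear (fun x => f x y z)) -> (forall x z, linear (fun y => f x y z)) ->
  (forall x y, linear (f x y)) ->
  (forall i j l, f (basis_vect i) (basis_vect j) (basis_vect l) \in R) ->
  forall x y z, f x y z \in R.
Proof.
have lmem (V : vectType k) (g : V -> U) :
  linear g -> (forall i, g (basis_vect i) \in R) -> forall v, g v \in R.
  move=> lg gR v; pose gL := GRing.isLinear.Build k V U *:%R g lg.
  pose g' : {linear V -> U} := HB.pack g gL.
  rewrite [v]basis_vectE -[g]/(g' : _ -> _) linear_sum memv_suml // => i _.
  by rewrite linearZ memvZ // gR.
move=> fx fy fz fR x y z; apply: (lmem _ (f x y)) => // l.
apply: (lmem _ (fun y => f x y (basis_vect l))) => // j.
by apply: (lmem _ (fun x => f x (basis_vect j) (basis_vect l))).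
Qed.

Lemma tensor_relation_mem m b n : tensor_relation m b n \in tensor_relations.
Proof.
apply: trilinear_mem m b n => [b n c x y|m n c x y|m b c x y|i j l].
- rewrite /tensor_relation ract_linear !pure_k_linearl scalerBr.
  by rewrite opprD addrACA.
- rewrite /tensor_relation ract_linearr lact_linearl pure_k_linearl pure_k_linearr.
  by rewrite scalerBr opprD addrACA.
- rewrite /tensor_relation lact_linear !pure_k_linearr scalerBr.
  by rewrite opprD addrACA.
rewrite /tensor_relations (bigD1 i) //= (subvP (addvSl _ _)) //.
rewrite (bigD1 j) //= (subvP (addvSl _ _)) //.
by rewrite (bigD1 l) //= (subvP (addvSl _ _)) // memv_line.
Qed.

Lemma tensor_proj_eq0 w : (tensor_proj w == 0) = (w \in tensor_relations).
Proof.
set R := tensor_relations.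
have dRR : (R^C :&: R = 0)%VS by rewrite capvC capv_compl.
have piC : daddv_pi R^C R w \in (R^C)%VS by apply: memv_pi.
have dec : daddv_pi R^C R w + daddv_pi R R^C w = w.
  by apply: daddv_pi_add => //; rewrite addvC addv_complf memvf.
rewrite -(inj_eq val_inj) /= vsprojK //.
apply/eqP/idP => [pi0 | wR].
  by rewrite -dec pi0 add0r memv_pi.
apply/eqP; rewrite -memv0 -dRR memv_cap piC /=.
have -> : daddv_pi R^C R w = w - daddv_pi R R^C w by rewrite -[in X in X - _]dec addrK.
by rewrite memvB // memv_pi.
Qed.

Lemma tensor_projK (t : tensor_space) : tensor_proj (vsval t) = t.
Proof.
apply: val_inj => /=; rewrite vsprojK ?memv_pi //.
by rewrite daddv_pi_id ?subvsP // capvC capv_compl.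
Qed.

Lemma pure_linearl n : linear (pure^~ n).
Proof. by move=> c x y; rewrite /pure pure_k_linearl linearP. Qed.

Lemma pure_linearr m : linear (pure m).
Proof. by move=> c x y; rewrite /pure pure_k_linearr linearP. Qed.

Lemma pure_balanced m b n : pure (ract m b) n = pure m (lact b n).
Proof.
apply/eqP; rewrite -subr_eq0 /pure -linearB tensor_proj_eq0.
exact: tensor_relation_mem.
Qed.

Lemma pure_k_delta i j : pure_k (basis_vect i) (basis_vect j) = delta_mx i j.
Proof. by rewrite /pure_k /basis_vect !r2vK trmx_delta mul_delta_mx. Qed.

Lemma tensor_span (t : tensor_space) :
  t = \sum_i \sum_j vsval t i j *: pure (basis_vect i) (basis_vect j).
Proof.
rewrite -[LHS]tensor_projK [X in tensor_proj X]matrix_sum_delta linear_sum.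
apply: eq_bigr => i _; rewrite linear_sum; apply: eq_bigr => j _.
by rewrite linearZ /pure pure_k_delta.
Qed.

Lemma tensor_ind (P : tensor_space -> Prop) :
    (forall m n, P (pure m n)) -> (forall c x y, P x -> P y -> P (c *: x + y)) ->
  forall t, P t.
Proof.
move=> Pp Pl t; have P0 : P 0.
  by have := Pl (-1) _ _ (Pp 0 0) (Pp 0 0); rewrite scaleN1r addNr.
have Psum (I : finType) (F : I -> tensor_space) :
  (forall i, P (F i)) -> P (\sum_i F i).
  move=> PF; elim/big_rec: _ => [|i x _ Px]; first exact: P0.
  by rewrite -[F i]scale1r; apply: Pl.
rewrite [t]tensor_span; apply: (Psum) => i; apply: (Psum) => j.
by rewrite -[_ *: _]addr0; apply: Pl.
Qed.

Lemma tensor_liftE (V : vectType k) (f : M -> N -> V) :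
    (forall n, linear (f^~ n)) -> (forall m, linear (f m)) ->
    (forall m b n, f (ract m b) n = f m (lact b n)) ->
  forall m n, tensor_lift f (pure m n) = f m n.
Proof.
move=> fl fr fb m n.
pose F (w : 'M[k]_(dim M, dim N)) : V :=
  \sum_i \sum_j w i j *: f (basis_vect i) (basis_vect j).
have F_linear : linear F.
  move=> c t u; rewrite /F scaler_sumr -big_split; apply: eq_bigr => i _.
  rewrite scaler_sumr -big_split; apply: eq_bigr => j _.
  by rewrite !mxE scalerDl scalerA.
pose FL := GRing.isLinear.Build k 'M[k]_(dim M, dim N) V *:%R F F_linear.
pose F' : {linear 'M[k]_(dim M, dim N) -> V} := HB.pack F FL.
have FE x y : F' (pure_k x y) = f x y.
  pose fxL z := GRing.isLinear.Build k N V *:%R (f z) (fr z).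
  pose fx z : {linear N -> V} := HB.pack (f z) (fxL z).
  pose fyL z := GRing.isLinear.Build k M V *:%R (f^~ z) (fl z).
  pose fy z : {linear M -> V} := HB.pack (f^~ z) (fyL z).
  transitivity (\sum_i v2r x 0 i *: fy y (basis_vect i)).
    rewrite /F' /= /F; apply: eq_bigr => i _.
    transitivity (v2r x 0 i *: (\sum_j v2r y 0 j *: fx (basis_vect i) (basis_vect j))).
      rewrite scaler_sumr; apply: eq_bigr => j _.
      by rewrite scalerA /pure_k mxE big_ord1 !mxE.
    congr (_ *: _); rewrite -[RHS]/(fx (basis_vect i) y) [in RHS](basis_vectE y).
    by rewrite linear_sum; apply: eq_bigr => j _; rewrite linearZ.
  rewrite -[RHS]/(fy y x) [in RHS](basis_vectE x) linear_sum.
  by apply: eq_bigr => i _; rewrite linearZ.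
have F0 w : w \in tensor_relations -> F' w = 0.
  case/memv_sumP=> wi wiP ->; rewrite linear_sum big1 // => i _.
  case/memv_sumP: (wiP i isT) => wj wjP ->; rewrite linear_sum big1 // => j _.
  case/memv_sumP: (wjP j isT) => wl wlP ->; rewrite linear_sum big1 // => l _.
  case/vlineP: (wlP l isT) => c ->; rewrite linearZ /tensor_relation.
  by rewrite linearB !FE fb subrr; apply: scaler0.
rewrite -[LHS]/(F' (vsval (pure m n))) -FE; apply/eqP; rewrite -subr_eq0 -linearB.
by rewrite F0 // -tensor_proj_eq0 linearB /= tensor_projK subrr.
Qed.

End Space.

Section Bimodule.

Variables (M : bimodule A B) (N : bimodule B C).

Definition tensor_lact a : tensor_space M N -> tensor_space M N :=
  tensor_lift (fun m n => pure (lact a m) n).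

Definition tensor_ract (t : tensor_space M N) c : tensor_space M N :=
  tensor_lift (fun m n => pure m (ract n c)) t.

Lemma tensor_lactE a m n : tensor_lact a (pure m n) = pure (lact a m) n.
Proof.
apply: tensor_liftE => [y c x x'|x c y y'|x b y].
- by rewrite linearP pure_linearl.
- by rewrite pure_linearr.
- by rewrite lractA pure_balanced.
Qed.

Lemma tensor_ractE c m n : tensor_ract (pure m n) c = pure m (ract n c).
Proof.
apply: tensor_liftE => [y d x x'|x d y y'|x b y].
- by rewrite pure_linearl.
- by rewrite ract_linear pure_linearr.
- by rewrite -lractA pure_balanced.
Qed.

Lemma tensor_lact_linear a : linear (tensor_lact a).
Proof. by move=> c x y; rewrite /tensor_lact linearP. Qed.

Lemma tensor_ract_linear c : linear (tensor_ract^~ c).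
Proof. by move=> d x y; rewrite /tensor_ract linearP. Qed.

Program Definition tensor_bimodule : bimodule A C :=
  @Bimodule k A C (tensor_space M N) tensor_lact tensor_ract _ _ _ _ _ _ _ _ _.
Next Obligation. exact: tensor_lact_linear. Qed.
Next Obligation.
move=> t c a a'; elim/tensor_ind: t => [m n|d x y IHx IHy].
  by rewrite !tensor_lactE lact_linearl pure_linearl.
by rewrite !tensor_lact_linear IHx IHy !scalerDr !scalerA mulrC addrACA.
Qed.
Next Obligation.
elim/tensor_ind=> [m n|d x y IHx IHy]; first by rewrite tensor_lactE lact1.
by rewrite tensor_lact_linear IHx IHy.
Qed.
Next Obligation.
move=> a a'; elim/tensor_ind=> [m n|d x y IHx IHy]; first by rewrite !tensor_lactE lactM.
by rewrite !tensor_lact_linear IHx IHy.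
Qed.
Next Obligation. exact: tensor_ract_linear. Qed.
Next Obligation.
move=> t c a a'; elim/tensor_ind: t => [m n|d x y IHx IHy].
  by rewrite !tensor_ractE ract_linearr pure_linearr.
by rewrite !tensor_ract_linear IHx IHy !scalerDr !scalerA mulrC addrACA.
Qed.
Next Obligation.
elim/tensor_ind=> [m n|d x y IHx IHy]; first by rewrite tensor_ractE ract1.
by rewrite tensor_ract_linear IHx IHy.
Qed.
Next Obligation.
move=> b b'; elim/tensor_ind=> [m n|d x y IHx IHy]; first by rewrite !tensor_ractE ractM.
by rewrite !tensor_ract_linear IHx IHy.
Qed.
Next Obligation.
move=> a c; elim/tensor_ind=> [m n|d x y IHx IHy].
  by rewrite tensor_ractE !tensor_lactE tensor_ractE.
by rewrite tensor_ract_linear !tensor_lact_linear tensor_ract_linear IHx IHy.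
Qed.

End Bimodule.

Section Map.

Variables (M : bimodule A B) (N N' : bimodule B C) (f : bimod_hom N N').

Definition tensor_map_fun : tensor_space M N -> tensor_space M N' :=
  tensor_lift (fun m n => pure m (f n)).

Lemma tensor_map_linear : linear tensor_map_fun.
Proof. by move=> c x y; rewrite /tensor_map_fun linearP. Qed.

HB.instance Definition _ :=
  GRing.isLinear.Build k (tensor_space M N) (tensor_space M N') *:%R
    tensor_map_fun tensor_map_linear.

Lemma tensor_mapE m n : tensor_map_fun (pure m n) = pure m (f n).
Proof.
apply: tensor_liftE => [y d x x'|x d y y'|x b y].
- by rewrite pure_linearl.
- by rewrite linearP pure_linearr.
- by rewrite bimod_hom_lact pure_balanced.
Qed.

Program Definition tensor_map :
    bimod_hom (tensor_bimodule M N) (tensor_bimodule M N') :=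
  @BimodHom k A C (tensor_bimodule M N) (tensor_bimodule M N')
    (linfun tensor_map_fun) _ _.
Next Obligation.
move=> a t; rewrite !lfunE /=.
elim/tensor_ind: t => [m n|d x y IHx IHy].
  by rewrite tensor_lactE !tensor_mapE tensor_lactE.
by rewrite tensor_lact_linear !tensor_map_linear IHx IHy tensor_lact_linear.
Qed.
Next Obligation.
move=> c t; rewrite !lfunE /=.
elim/tensor_ind: t => [m n|d x y IHx IHy].
  by rewrite tensor_ractE !tensor_mapE tensor_ractE bimod_hom_ract.
by rewrite tensor_ract_linear !tensor_map_linear IHx IHy tensor_ract_linear.
Qed.

End Map.
End Tensor.

Section Functors.

Variable k : fieldType.

Record functor (A B : falgType k) := Functor {
  fobj :> lmodule A -> lmodule B;
  fmap : forall X Y : lmodule A, bimod_hom X Y -> bimod_hom (fobj X) (fobj Y);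
  fmap_id : forall X, fmap (bimod_id X) = bimod_id (fobj X);
  fmap_comp : forall X Y Z (g : bimod_hom Y Z) (f : bimod_hom X Y),
    fmap (bimod_comp g f) = bimod_comp (fmap g) (fmap f) }.

Program Definition tensor_functor (A B : falgType k) (M : bimodule A B) : functor B A :=
  @Functor B A (fun X => tensor_bimodule M X) (fun X Y f => tensor_map M f) _ _.
Next Obligation.
move=> A B M X; apply: bimod_homP => t; rewrite lfunE id_lfunE /=.
elim/tensor_ind: t => [m x|c x y IHx IHy]; last by rewrite tensor_map_linear IHx IHy.
by rewrite tensor_mapE id_lfunE.
Qed.
Next Obligation.
move=> A B M X Y Z g f; apply: bimod_homP => t; rewrite comp_lfunE !lfunE /=.
elim/tensor_ind: t => [m x|c x y IHx IHy]; last by rewrite !tensor_map_linear IHx IHy.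
by rewrite !tensor_mapE comp_lfunE.
Qed.

(* F is left adjoint to G. *)
Definition adjoint (A B : falgType k) (F : functor A B) (G : functor B A) : Prop :=
  exists phi : forall (X : lmodule A) (Y : lmodule B),
      bimod_hom (F X) Y -> bimod_hom X (G Y),
    (forall X Y, bijective (phi X Y)) /\
    (forall (X X' : lmodule A) (Y Y' : lmodule B)
        (u : bimod_hom X' X) (v : bimod_hom Y Y') (f : bimod_hom (F X) Y),
      phi X' Y' (bimod_comp v (bimod_comp f (fmap F u))) =
      bimod_comp (fmap G v) (bimod_comp (phi X Y f) u)).

Definition biadjoint (A B : falgType k) (F : functor A B) (G : functor B A) : Prop :=
  adjoint F G /\ adjoint G F.

Definition left_right_projective (A B : falgType k) (M : bimodule A B) : Prop :=
  projective (left_module M) /\ projective (right_module M).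

Definition symmetrically_separably_equivalent (A B : falgType k) : Prop :=
  exists (M : bimodule A B) (N : bimodule B A),
    [/\ left_right_projective M,
        left_right_projective N,
        direct_summand (regular_bimodule A) (tensor_bimodule M N),
        direct_summand (regular_bimodule B) (tensor_bimodule N M) &
        biadjoint (tensor_functor M) (tensor_functor N)].

End Functors.

(* Invertibility of each alpha g follows from the action axioms. *)
Record alg_action (k : fieldType) (gT : finGroupType) (A : falgType k) := AlgAction {
  alg_act :> gT -> {lrmorphism A -> A};
  alg_act1 : forall a, alg_act 1%g a = a;
  alg_actM : forall g h a, alg_act (g * h)%g a = alg_act g (alg_act h a) }.

(* A (x) kG is identified with the functions gT -> A, a (x) g being the function
   supported at g with value a, see skew_tensM. *)
Definition skew_group_alg (k : fieldType) (gT : finGroupType) (A : falgType k)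
  (alpha : alg_action gT A) : Type := {ffun gT -> A}.

Section SkewGroupAlgebra.

Variables (k : fieldType) (gT : finGroupType) (A : falgType k).
Variable alpha : alg_action gT A.

Local Notation S := (skew_group_alg alpha).

HB.instance Definition _ := Vector.copy S {ffun gT -> A}.

Definition skew_tens (a : A) (g : gT) : S := [ffun x => if x == g then a else 0].

Definition skew_mul (u v : S) : S :=
  \sum_(g : gT) \sum_(h : gT) skew_tens (u g * alpha g (v h)) (g * h)%g.

Lemma skew_mulE u v x : skew_mul u v x = \sum_g u g * alpha g (v (g^-1 * x)%g).
Proof.
rewrite /skew_mul sum_ffunE; apply: eq_bigr => g _; rewrite sum_ffunE.
rewrite (bigD1 (g^-1 * x)%g) //= big1 ?addr0 => [|h hx].
  by rewrite ffunE mulKVg eqxx.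
by rewrite ffunE; case: eqP => // xE; move: hx; rewrite xE mulKg eqxx.
Qed.

Lemma skew_mulA : associative skew_mul.
Proof.
move=> u v w; apply/ffunP => x; rewrite !skew_mulE.
under eq_bigr => g _ do rewrite skew_mulE linear_sum mulr_sumr.
under [RHS]eq_bigr => g _ do rewrite skew_mulE mulr_suml.
rewrite [RHS]exchange_big; apply: eq_bigr => g _ /=.
rewrite [RHS](reindex_inj (mulgI g)); apply: eq_bigr => h _ /=.
by rewrite rmorphM mulrA mulKg alg_actM invMg mulgA.
Qed.

Lemma skew_mul1 : left_id (skew_tens 1 1%g) skew_mul.
Proof.
move=> u; apply/ffunP => x; rewrite skew_mulE (bigD1 1%g) //= big1.
  by rewrite ffunE eqxx addr0 mul1r alg_act1 invg1 mul1g.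
by move=> g /negbTE g1; rewrite ffunE g1 mul0r.
Qed.

Lemma skew_mulr1 : right_id (skew_tens 1 1%g) skew_mul.
Proof.
move=> u; apply/ffunP => x; rewrite skew_mulE (bigD1 x) //= big1.
  by rewrite ffunE mulVg eqxx addr0 rmorph1 mulr1.
by move=> g /negbTE gx; rewrite ffunE -eq_mulVg1 gx rmorph0 mulr0.
Qed.

Lemma skew_mulDl : left_distributive skew_mul +%R.
Proof.
move=> u v w; apply/ffunP => x; rewrite ffunE !skew_mulE -big_split.
by apply: eq_bigr => g _; rewrite ffunE mulrDl.
Qed.

Lemma skew_mulDr : right_distributive skew_mul +%R.
Proof.
move=> u v w; apply/ffunP => x; rewrite ffunE !skew_mulE -big_split.
by apply: eq_bigr => g _; rewrite ffunE linearD mulrDr.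
Qed.

Lemma skew_neq0 : skew_tens 1 1%g != 0.
Proof. by apply/eqP => /ffunP/(_ 1%g)/eqP; rewrite !ffunE eqxx oner_eq0. Qed.

HB.instance Definition _ := GRing.Zmodule_isNzRing.Build S
  skew_mulA skew_mul1 skew_mulr1 skew_mulDl skew_mulDr skew_neq0.

Lemma skew_scaleAl c (u v : S) : c *: (u * v) = (c *: u) * v.
Proof.
apply/ffunP => x; rewrite ffunE !skew_mulE scaler_sumr.
by apply: eq_bigr => g _; rewrite ffunE scalerAl.
Qed.

HB.instance Definition _ := GRing.Lmodule_isLalgebra.Build k S skew_scaleAl.

Lemma skew_scaleAr c (u v : S) : c *: (u * v) = u * (c *: v).
Proof.
apply/ffunP => x; rewrite ffunE !skew_mulE scaler_sumr.
by apply: eq_bigr => g _; rewrite ffunE linearZ scalerAr.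
Qed.

HB.instance Definition _ := GRing.Lalgebra_isAlgebra.Build k S skew_scaleAr.
HB.instance Definition _ := Algebra_isFalgebra.Build k S.

Lemma skew_tensM a g a' g' :
  skew_tens a g * skew_tens a' g' = skew_tens (a * alpha g a') (g * g')%g.
Proof.
apply/ffunP => x; rewrite skew_mulE (bigD1 g) //= big1 => [|h /negbTE hg].
  rewrite !ffunE eqxx addr0 (can2_eq (mulKVg g) (mulKg g)).
  by case: eqP => // _; rewrite rmorph0 mulr0.
by rewrite ffunE hg mul0r.
Qed.

End SkewGroupAlgebra.

(* Main.v *)
Require Import Defs.
From HB Require Import structures.
From mathcomp Require Import all_boot all_fingroup all_algebra all_field.
From mathcomp Require boolp.
(* [ract] is also a restricted group action; this selects the bimodule action. *)
Import Defs.

Set Implicit Arguments.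
Unset Strict Implicit.
Unset Printing Implicit Defensive.

Import GRing.Theory.
Local Open Scope ring_scope.

#[local] Obligation Tactic := idtac.

(** The skew group algebra S = A * G is a Frobenius extension of A which is split
    and has a separability idempotent proportional to its Casimir element.  Any
    extension io : A -> S of this kind is symmetrically separably equivalent to
    its base ([split_separable_frobenius_equivalent]).

    The data are an A-A-bilinear map E : S -> A and dual bases (x_i), (y_i) with
      sum_i x_i io(E(y_i s)) = s = sum_i io(E(s x_i)) y_i   for all s in S.
    The bimodules are M = S as an A-S-bimodule and N = S as an S-A-bimodule, so
    that tensoring with M is restriction of S-modules to A, and tensoring with N
    is induction from A to S.

    - On one side M and N are free of rank one; on the other, by the identities
      above, (y_i) and (x_i) generate them with A-linear coordinate functions
      s |-> E(s x_i) and s |-> E(y_i s), so they are projective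
      ([restriction_projective], [induction_projective]).
    - The identities also make sum_i x_i (x) y_i in S (x)_A S a Casimir element:
      multiplying it by s on the left or on the right gives the same result
      ([casimir]).
    - Induction is left adjoint to restriction, as for any algebra morphism.  It is
      also right adjoint: f : M (x)_S X -> Y has transpose
      v |-> sum_i x_i (x) f (y_i (x) v), which is S-linear because of the Casimir
      property, and is inverted with the help of n (x) v |-> E(n) v.
    - If E o io = id, then A is a retract of M (x)_S N, which is S.  If
      sum_i x_i y_i is a nonzero scalar c, then
      s |-> c^-1 sum_i s x_i (x) y_i is a bilinear section of the multiplication
      N (x)_A M -> S, so that S is a retract of N (x)_A M.  A retract of
      bimodules is a direct summand ([retract_direct_summand]).

    For S = A * G, take for E the coefficient at the identity of G, and
    x_g = 1 (x) g, y_g = 1 (x) g^-1 for g in G.  Then E o io = id, and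
    sum_g x_g y_g = |G|, which is nonzero in the field by the hypothesis on its
    characteristic. *)

(** * Linear maps and bimodule morphisms *)

(** Many maps below are linear without having a canonical linear structure (an
    action in one of its two variables, a tensor in one factor), whence these
    variants of the usual lemmas, which take linearity as an argument. *)
Section LinearFunctions.

Variables (k : fieldType) (U V : vectType k) (f : U -> V).
Hypothesis f_linear : linear f.

Let fL := GRing.isLinear.Build k U V *:%R f f_linear.
Let f' : {linear U -> V} := HB.pack f fL.

Lemma linear_fun_sum (I : finType) (F : I -> U) :
  f (\sum_i F i) = \sum_i f (F i).
Proof. exact: (linear_sum f'). Qed.

Lemma linear_funZ c u : f (c *: u) = c *: f u.
Proof. exact: (linearZ_LR f'). Qed.

Lemma linfun_of_linear u : linfun f' u = f u.
Proof. by rewrite lfunE. Qed.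

Definition lfun_of_linear := linfun f'.

End LinearFunctions.

Section Homs.

Variables (k : fieldType) (A B : falgType k).

Section Make.

Variables (M N : bimodule A B) (f : M -> N).
Hypothesis f_linear : linear f.
Hypothesis f_lact : forall a x, f (lact a x) = lact a (f x).
Hypothesis f_ract : forall b x, f (ract x b) = ract (f x) b.

Program Definition hom_of_linear : bimod_hom M N :=
  @BimodHom k A B M N (lfun_of_linear f_linear) _ _.
Next Obligation. by move=> a x; rewrite /lfun_of_linear !linfun_of_linear. Qed.
Next Obligation. by move=> a x; rewrite /lfun_of_linear !linfun_of_linear. Qed.

Lemma hom_of_linearE x : hom_of_linear x = f x.
Proof. exact: linfun_of_linear. Qed.

End Make.

Lemma bimod_hom_linear (M N : bimodule A B) (f : bimod_hom M N) : linear f.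
Proof. by move=> c x y; rewrite linearP. Qed.

End Homs.

(** One-sided modules are bimodules over the field on the other side, where the
    action can only be scaling; so one-sided linearity is all there is to check
    for a morphism between them. *)
Lemma lmod_ractE (k : fieldType) (A : falgType k) (X : lmodule A) (x : X) (c : k) :
  ract x (c : k^o) = c *: x.
Proof.
rewrite -[in RHS](ract1 x) -(linear_funZ (@ract_linearr _ _ _ X x)).
by rewrite -[c in LHS]mulr1.
Qed.

Lemma rmod_lactE (k : fieldType) (B : falgType k) (X : rmodule B) (x : X) (c : k) :
  lact (c : k^o) x = c *: x.
Proof.
rewrite -[in RHS](lact1 x) -(linear_funZ (@lact_linearl _ _ _ X x)).
by rewrite -[c in LHS]mulr1.
Qed.

Section OneSided.

Variables (k : fieldType) (A : falgType k).

Section Left.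
Variables (X Y : lmodule A) (f : X -> Y).
Hypotheses (f_linear : linear f) (f_lact : forall a x, f (lact a x) = lact a (f x)).

Lemma lmod_hom_ract (c : k^o) x : f (ract x c) = ract (f x) c.
Proof. by rewrite !lmod_ractE (linear_funZ f_linear). Qed.

Definition lmod_hom := hom_of_linear f_linear f_lact lmod_hom_ract.

Lemma lmod_homE x : lmod_hom x = f x. Proof. exact: hom_of_linearE. Qed.

End Left.

Section Right.
Variables (X Y : rmodule A) (f : X -> Y).
Hypotheses (f_linear : linear f) (f_ract : forall a x, f (ract x a) = ract (f x) a).

Lemma rmod_hom_lact (c : k^o) x : f (lact c x) = lact c (f x).
Proof. by rewrite !rmod_lactE (linear_funZ f_linear). Qed.

Definition rmod_hom := hom_of_linear f_linear rmod_hom_lact f_ract.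

Lemma rmod_homE x : rmod_hom x = f x. Proof. exact: hom_of_linearE. Qed.

End Right.

End OneSided.

(** * Direct summands and projectivity *)

Section Kernel.

Variables (k : fieldType) (A B : falgType k) (P Q : bimodule A B).
Variable q : bimod_hom P Q.

Local Notation K := (lker q).

Lemma lact_ker a (x : subvs_of K) : lact a (vsval x) \in K.
Proof.
rewrite memv_ker bimod_hom_lact (eqP (_ : q (vsval x) == 0)) ?linear0 //.
by rewrite -memv_ker subvsP.
Qed.

Lemma ract_ker b (x : subvs_of K) : ract (vsval x) b \in K.
Proof.
rewrite memv_ker bimod_hom_ract (eqP (_ : q (vsval x) == 0)) -?memv_ker ?subvsP //.
by rewrite -[ract 0 b]/(ractr b 0) linear0.
Qed.

Program Definition kernel_bimodule : bimodule A B :=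
  @Bimodule k A B (subvs_of K)
    (fun a x => vsproj K (lact a (vsval x))) (fun x b => vsproj K (ract (vsval x) b))
    _ _ _ _ _ _ _ _ _.
Next Obligation. by move=> a c x y; rewrite /= !linearP. Qed.
Next Obligation. by move=> x c a b; rewrite /= lact_linearl linearP. Qed.
Next Obligation. by move=> x; rewrite /= lact1 vsvalK. Qed.
Next Obligation. by move=> a b x; rewrite /= vsprojK ?lact_ker // lactM. Qed.
Next Obligation. by move=> b c x y; rewrite -!/(ractr _ _) !linearP. Qed.
Next Obligation. by move=> x c a b; rewrite /= ract_linearr linearP. Qed.
Next Obligation. by move=> x; rewrite /= ract1 vsvalK. Qed.
Next Obligation. by move=> a b x; rewrite /= vsprojK ?ract_ker // ractM. Qed.
Next Obligation. by move=> a b x; rewrite /= !vsprojK ?lact_ker ?ract_ker // lractA. Qed.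

End Kernel.

(** The complement of the image of j is the kernel of q: an element z is
    j (q z) + (z - j (q z)). *)
Lemma retract_direct_summand (k : fieldType) (A B : falgType k)
    (P Q : bimodule A B) (j : bimod_hom P Q) (q : bimod_hom Q P) :
  cancel j q -> direct_summand P Q.
Proof.
move=> jK; exists (kernel_bimodule q).
pose f (z : bimod_sum P (kernel_bimodule q)) : Q := j z.1 + vsval z.2.
have f_linear : linear f.
  by move=> c x y; rewrite /f !linearP scalerDr addrACA.
have f_lact a x : f (lact a x) = lact a (f x).
  by rewrite /f /= vsprojK ?lact_ker // bimod_hom_lact linearD.
have f_ract b x : f (ract x b) = ract (f x) b.
  rewrite /f /= vsprojK ?ract_ker // bimod_hom_ract.
  by rewrite -[RHS]/(ractr b (_ + _)) linearD.
exists (hom_of_linear f_linear f_lact f_ract).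
pose g (z : Q) : bimod_sum P (kernel_bimodule q) :=
  (q z, vsproj (lker q) (z - j (q z))).
exists g => [[x y]|z]; rewrite hom_of_linearE /f /g /=.
  have qy : q (vsval y) = 0 by apply/eqP; rewrite -memv_ker subvsP.
  have -> : q (j x + vsval y) = x by rewrite linearD /= jK qy addr0.
  by rewrite addrC addKr vsvalK.
by rewrite vsprojK ?memv_ker ?linearB /= ?jK ?subrr // addrC subrK.
Qed.

Section DualBasis.

Variables (k : fieldType) (A : falgType k) (I : finType).

(** The y_i, with coordinate functions e_i, are the images of a basis of a free
    module that P is a summand of; a morphism from P is lifted by lifting its
    values at the y_i. *)
Lemma left_dual_basis_projective (P : lmodule A) (y : I -> P) (e : I -> P -> A) :
    (forall i, linear (e i)) -> (forall i a x, e i (lact a x) = a * e i x) ->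
    (forall x, \sum_i lact (e i x) (y i) = x) ->
  projective P.
Proof.
move=> el ea ey X Y p f p_surj.
have [z zP] := boolp.choice (fun i => p_surj (f (y i))).
pose h (x : P) : X := \sum_i lact (e i x) (z i).
have hl : linear h.
  move=> c u v; rewrite /h scaler_sumr -big_split; apply: eq_bigr => i _ /=.
  by rewrite el lact_linearl.
have ha a x : h (lact a x) = lact a (h x).
  by rewrite /h linear_sum; apply: eq_bigr => i _ /=; rewrite ea lactM.
exists (lmod_hom hl ha); apply: bimod_homP => x.
rewrite comp_lfunE lmod_homE /h -[in RHS](ey x) !linear_sum /=.
by apply: eq_bigr => i _; rewrite !bimod_hom_lact zP.
Qed.

Lemma right_dual_basis_projective (P : rmodule A) (x : I -> P) (e : I -> P -> A) :
    (forall i, linear (e i)) -> (forall i a u, e i (ract u a) = e i u * a) ->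
    (forall u, \sum_i ract (x i) (e i u) = u) ->
  projective P.
Proof.
move=> el ea ex X Y p f p_surj.
have [z zP] := boolp.choice (fun i => p_surj (f (x i))).
pose h (u : P) : X := \sum_i ract (z i) (e i u).
have hl : linear h.
  move=> c u v; rewrite /h scaler_sumr -big_split; apply: eq_bigr => i _ /=.
  by rewrite el ract_linearr.
have ha a u : h (ract u a) = ract (h u) a.
  rewrite /h (linear_fun_sum (@ract_linear _ _ _ X a)).
  by apply: eq_bigr => i _ /=; rewrite ea ractM.
exists (rmod_hom hl ha); apply: bimod_homP => u.
rewrite comp_lfunE rmod_homE /h -[in RHS](ex u) !linear_sum /=.
by apply: eq_bigr => i _; rewrite !bimod_hom_ract zP.
Qed.

End DualBasis.

(** * Morphisms out of tensor products *)

Section TensorHom.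

Variables (k : fieldType) (A B C : falgType k).
Variables (M : bimodule A B) (N : bimodule B C) (P : bimodule A C).

Lemma eq_tensor_hom (f g : bimod_hom (tensor_bimodule M N) P) :
  (forall m n, f (pure m n) = g (pure m n)) -> f = g.
Proof.
move=> fg; apply: bimod_homP; elim/tensor_ind=> // c x y IHx IHy.
by rewrite !bimod_hom_linear IHx IHy.
Qed.

(** Composing f with [pure] passes from the carrier of the tensor product to its
    bimodule structure, which hides linearity from rewriting. *)
Lemma tensor_hom_linearl (f : bimod_hom (tensor_bimodule M N) P) n :
  linear (fun m => f (pure m n)).
Proof. by move=> c m m'; rewrite pure_linearl; apply: bimod_hom_linear. Qed.

Lemma tensor_hom_linearr (f : bimod_hom (tensor_bimodule M N) P) m :
  linear (fun n => f (pure m n)).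
Proof. by move=> c n n'; rewrite pure_linearr; apply: bimod_hom_linear. Qed.

Lemma pure_suml (I : finType) (F : I -> M) (n : N) :
  pure (\sum_i F i) n = \sum_i pure (F i) n.
Proof. exact: (linear_fun_sum (@pure_linearl _ _ _ _ M N n)). Qed.

Variable f : M -> N -> P.
Hypotheses (fl : forall n, linear (f^~ n)) (fr : forall m, linear (f m)).
Hypothesis fb : forall m b n, f (ract m b) n = f m (lact b n).
Hypothesis f_lact : forall a m n, f (lact a m) n = lact a (f m n).
Hypothesis f_ract : forall c m n, f m (ract n c) = ract (f m n) c.

Lemma tensor_lift_lact a (t : tensor_bimodule M N) :
  tensor_lift f (lact a t) = lact a (tensor_lift f t).
Proof.
elim/tensor_ind: t => [m n|c x y IHx IHy].
  by rewrite /= tensor_lactE !tensor_liftE.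
by rewrite lact_linear !tensor_lift_linear IHx IHy lact_linear.
Qed.

Lemma tensor_lift_ract c (t : tensor_bimodule M N) :
  tensor_lift f (ract t c) = ract (tensor_lift f t) c.
Proof.
elim/tensor_ind: t => [m n|d x y IHx IHy].
  by rewrite /= tensor_ractE !tensor_liftE.
by rewrite ract_linear !tensor_lift_linear IHx IHy ract_linear.
Qed.

Definition tensor_hom : bimod_hom (tensor_bimodule M N) P :=
  @hom_of_linear _ _ _ (tensor_bimodule M N) P _
    (tensor_lift_linear f) tensor_lift_lact tensor_lift_ract.

Lemma tensor_homE m n : tensor_hom (pure m n) = f m n.
Proof. by rewrite hom_of_linearE tensor_liftE. Qed.

End TensorHom.

Section TensorLmodHom.

Variables (k : fieldType) (A B : falgType k).
Variables (M : bimodule A B) (X : lmodule B) (P : lmodule A) (f : M -> X -> P).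
Hypotheses (fl : forall x, linear (f^~ x)) (fr : forall m, linear (f m)).
Hypothesis fb : forall m b x, f (ract m b) x = f m (lact b x).
Hypothesis f_lact : forall a m x, f (lact a m) x = lact a (f m x).

Lemma tensor_lmod_ract (c : k^o) m x : f m (ract x c) = ract (f m x) c.
Proof. by rewrite !lmod_ractE (linear_funZ (fr m)). Qed.

Definition tensor_lmod_hom := tensor_hom fl fr fb f_lact tensor_lmod_ract.

Lemma tensor_lmod_homE m x : tensor_lmod_hom (pure m x) = f m x.
Proof. exact: tensor_homE. Qed.

End TensorLmodHom.

Lemma tensor_functorE (k : fieldType) (A B : falgType k) (M : bimodule A B)
    (X Y : lmodule B) (u : bimod_hom X Y) m v :
  fmap (tensor_functor M) u (pure m v) = pure m (u v).
Proof. by rewrite /= lfunE /= tensor_mapE. Qed.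

(** * Frobenius extensions *)

(** The classical Frobenius extensions of rings: S is finitely generated projective
    over A, and isomorphic to Hom_A(S, A).  The trace (Frobenius homomorphism) and
    the dual bases are the equational form of this. *)
Record frobenius_extension (k : fieldType) (A S : falgType k) (I : finType) :=
  FrobeniusExtension {
    incl : {lrmorphism A -> S};
    trace : {linear S -> A};
    dual_l : I -> S;
    dual_r : I -> S;
    trace_lact : forall a s, trace (incl a * s) = a * trace s;
    trace_ract : forall s a, trace (s * incl a) = trace s * a;
    dual_lP : forall s, \sum_i dual_l i * incl (trace (dual_r i * s)) = s;
    dual_rP : forall s, \sum_i incl (trace (s * dual_l i)) * dual_r i = s }.

Section Frobenius.

Variables (k : fieldType) (A S : falgType k) (I : finType).
Variable F : frobenius_extension A S I.

Local Notation io := (incl F).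
Local Notation E := (trace F).
Local Notation x := (dual_l F).
Local Notation y := (dual_r F).

Program Definition restriction_bimodule : bimodule A S :=
  @Bimodule k A S S (fun a s => io a * s) *%R _ _ _ _ _ _ _ _ _.
Next Obligation. by move=> a c s t; rewrite /= mulrDr scalerAr. Qed.
Next Obligation. by move=> s c a b; rewrite /= linearP mulrDl scalerAl. Qed.
Next Obligation. by move=> s; rewrite /= rmorph1 mul1r. Qed.
Next Obligation. by move=> a b s; rewrite /= rmorphM mulrA. Qed.
Next Obligation. by move=> b c s t; rewrite /= mulrDl scalerAl. Qed.
Next Obligation. by move=> s c a b; rewrite /= mulrDr scalerAr. Qed.
Next Obligation. by move=> s; rewrite /= mulr1. Qed.
Next Obligation. by move=> a b s; rewrite /= mulrA. Qed.
Next Obligation. by move=> a b s; rewrite /= mulrA. Qed.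

Program Definition induction_bimodule : bimodule S A :=
  @Bimodule k S A S *%R (fun s a => s * io a) _ _ _ _ _ _ _ _ _.
Next Obligation. by move=> a c s t; rewrite /= mulrDr scalerAr. Qed.
Next Obligation. by move=> s c a b; rewrite /= mulrDl scalerAl. Qed.
Next Obligation. by move=> s; rewrite /= mul1r. Qed.
Next Obligation. by move=> a b s; rewrite /= mulrA. Qed.
Next Obligation. by move=> b c s t; rewrite /= mulrDl scalerAl. Qed.
Next Obligation. by move=> s c a b; rewrite /= linearP mulrDr scalerAr. Qed.
Next Obligation. by move=> s; rewrite /= rmorph1 mulr1. Qed.
Next Obligation. by move=> a b s; rewrite /= rmorphM mulrA. Qed.
Next Obligation. by move=> a b s; rewrite /= mulrA. Qed.

Local Notation M := restriction_bimodule.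
Local Notation N := induction_bimodule.

(* Both bimodules have carrier S, so actions are told apart by the type at which an
   element is read; these equations select one of them by hand. *)
Lemma restriction_lactE a (s : S) : lact a (s : M) = io a * s. Proof. by []. Qed.
Lemma induction_lactE (s t : S) : lact s (t : N) = s * t. Proof. by []. Qed.
Lemma induction_ractE (s : S) a : ract (s : N) a = s * io a. Proof. by []. Qed.

Lemma mulr_linear (s : S) : linear ( *%R s).
Proof. by move=> c t u; rewrite mulrDr scalerAr. Qed.

Lemma mulrr_linear (s : S) : linear (fun t => t * s).
Proof. by move=> c t u; rewrite mulrDl scalerAl. Qed.

(** Over A on the left, S has the dual basis y_i with coordinates s |-> E(s x_i);
    over S on the right it is free on 1. *)
Lemma restriction_projective : left_right_projective M.
Proof.
split.
  apply: (@left_dual_basis_projective _ _ _ (left_module M) y (fun i s => E (s * x i))).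
  - by move=> i c s t; rewrite mulrr_linear linearP.
  - by move=> i a s; rewrite /= -mulrA trace_lact.
  - exact: dual_rP.
apply: (@right_dual_basis_projective _ _ unit (right_module M)
  (fun=> 1) (fun _ => id)) => // s.
by rewrite (bigD1 tt) //= big1 ?addr0 ?mul1r // => -[].
Qed.

(** Over S on the left, S is free on 1; over A on the right it has the dual basis
    x_i with coordinates s |-> E(y_i s). *)
Lemma induction_projective : left_right_projective N.
Proof.
split.
  apply: (@left_dual_basis_projective _ _ unit (left_module N)
    (fun=> 1) (fun _ => id)) => // s.
  by rewrite (bigD1 tt) //= big1 ?addr0 ?mulr1 // => -[].
apply: (@right_dual_basis_projective _ _ _ (right_module N) x (fun i s => E (y i * s))).
- by move=> i c s t; rewrite mulr_linear linearP.
- by move=> i a s; rewrite /= mulrA trace_ract.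
- exact: dual_lP.
Qed.

(** This is sum_i x_i (x) y_i s = sum_i s x_i (x) y_i in S (x)_A S, in the form of
    its image under an arbitrary A-balanced bilinear map b.  Expanding y_i s in the
    y_j, the coefficients E(y_i s x_j) move across b and collect s x_j from the
    x_i. *)
Lemma casimir (V : vectType k) (b : S -> S -> V) (s : S) :
    (forall t, linear (b^~ t)) -> (forall t, linear (b t)) ->
    (forall t a u, b (t * io a) u = b t (io a * u)) ->
  \sum_i b (x i) (y i * s) = \sum_i b (s * x i) (y i).
Proof.
move=> bl br bb.
transitivity (\sum_i \sum_j b (x i * io (E (y i * (s * x j)))) (y j)).
  apply: eq_bigr => i _; rewrite -[y i * s in LHS](dual_rP F) (linear_fun_sum (br _)).
  by apply: eq_bigr => j _; rewrite bb mulrA.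
rewrite exchange_big; apply: eq_bigr => j _ /=.
by rewrite -(linear_fun_sum (bl _)) dual_lP.
Qed.

(** * The summand conditions *)

(** M (x)_S N is S through multiplication, and A is split off S by io and E. *)
Lemma restriction_induction_summand :
  (forall a, E (io a) = a) -> direct_summand (regular_bimodule A) (tensor_bimodule M N).
Proof.
move=> EioK.
have qn (n : N) : linear (fun m : M => E (m * n) : regular_bimodule A).
  by move=> c m m'; rewrite (mulrr_linear n) linearP.
have qm (m : M) : linear (fun n : N => E (m * n) : regular_bimodule A).
  by move=> c n n'; rewrite (mulr_linear m) linearP.
have qb (m : M) (b : S) (n : N) : E (ract m b * n) = E (m * lact b n).
  by rewrite /= mulrA.
have ql a (m : M) (n : N) :
    E (lact a m * n) = lact a (E (m * n) : regular_bimodule A).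
  by rewrite /= -mulrA trace_lact.
have qr a (m : M) (n : N) :
    E (m * ract n a) = ract (E (m * n) : regular_bimodule A) a.
  by rewrite /= mulrA trace_ract.
pose j (a : regular_bimodule A) : tensor_bimodule M N := pure (io a : M) (1 : N).
have jl : linear j by move=> c a b; rewrite /j linearP pure_linearl.
have ja a b : j (lact a b) = lact a (j b).
  by rewrite /j /= tensor_lactE /= rmorphM.
have jr a b : j (ract b a) = ract (j b) a.
  rewrite /j /= tensor_ractE /= mul1r -[io a]mulr1 -induction_lactE -pure_balanced.
  by rewrite /= rmorphM.
apply: (@retract_direct_summand _ _ _ _ _
  (hom_of_linear jl ja jr) (tensor_hom qn qm qb ql qr)) => a.
by rewrite hom_of_linearE tensor_homE mulr1 EioK.
Qed.

(** The multiplication N (x)_A M -> S is split by sending 1 to the Casimir element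
    divided by c; [casimir] is what makes this section right S-linear. *)
Lemma induction_restriction_summand (c : k) :
    c != 0 -> \sum_i x i * y i = c *: 1 ->
  direct_summand (regular_bimodule S) (tensor_bimodule N M).
Proof.
move=> c0 xyE.
have qb (n : N) (a : A) (m : M) : ract n a * m = n * lact a m :> S.
  by rewrite /= mulrA.
have ql (s : S) (n : N) (m : M) : lact s n * m = s * (n * m) :> S.
  by rewrite /= mulrA.
have qr (s : S) (n : N) (m : M) : n * ract m s = n * m * s :> S.
  by rewrite /= mulrA.
pose p (s t : S) : tensor_bimodule N M := pure (s : N) (t : M).
have pl t : linear (p^~ t) by move=> d u u'; rewrite /p pure_linearl.
have pr s : linear (p s) by move=> d u u'; rewrite /p pure_linearr.
have pb s a t : p (s * io a) t = p s (io a * t).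
  by rewrite /p -induction_ractE pure_balanced.
pose j (s : regular_bimodule S) := c^-1 *: \sum_i p (s * x i) (y i).
have jl : linear j.
  move=> d s t; rewrite /j scalerA mulrC -scalerA -scalerDr; congr (_ *: _).
  by rewrite scaler_sumr -big_split; apply: eq_bigr => i _; rewrite mulrr_linear pl.
have ja s t : j (lact s t) = lact s (j t).
  have ll := @lact_linear _ _ _ (tensor_bimodule N M) s.
  rewrite /j (linear_funZ ll) (linear_fun_sum ll); congr (_ *: _).
  by apply: eq_bigr => i _; rewrite /p /= tensor_lactE /= mulrA.
have jr s t : j (ract t s) = ract (j t) s.
  have rl := @ract_linear _ _ _ (tensor_bimodule N M) s.
  rewrite /j (linear_funZ rl) (linear_fun_sum rl); congr (_ *: _).
  transitivity (\sum_i p (t * x i) (y i * s)).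
    rewrite (@casimir _ (fun u v => p (t * u) v)).
    - by apply: eq_bigr => i _; rewrite /= mulrA.
    - by move=> v d u u'; rewrite mulr_linear pl.
    - by move=> u; apply: pr.
    - by move=> u a v; rewrite mulrA pb.
  by apply: eq_bigr => i _; rewrite /p /= tensor_ractE.
apply: (@retract_direct_summand _ _ _ _ _ (hom_of_linear jl ja jr)
  (@tensor_hom _ _ _ _ N M (regular_bimodule S) _
    mulrr_linear mulr_linear qb ql qr)) => s.
rewrite hom_of_linearE /j (linear_funZ (bimod_hom_linear _)).
rewrite (linear_fun_sum (bimod_hom_linear _)).
under eq_bigr => i _ do rewrite tensor_homE -mulrA.
by rewrite -mulr_sumr xyE -scalerAr mulr1 scalerA mulVf ?scale1r.
Qed.

(** * The two adjunctions *)

Section TraceCounit.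

Variable Y : lmodule A.

(** The counit of the adjunction in which induction is the right adjoint. *)
Definition trace_counit : tensor_bimodule N Y -> Y :=
  tensor_lift (fun (n : N) v => lact (E n) v).

Lemma trace_counit_linear : linear trace_counit.
Proof. exact: tensor_lift_linear. Qed.

Lemma trace_counitE (n : N) v : trace_counit (pure n v) = lact (E n) v.
Proof.
apply: tensor_liftE => [u c s t|s|s a u].
- by rewrite linearP lact_linearl.
- exact: lact_linear.
- by rewrite /= trace_ract lactM.
Qed.

Lemma trace_counit_lact a t : trace_counit (lact (io a) t) = lact a (trace_counit t).
Proof.
elim/tensor_ind: t => [n v|c t u IHt IHu].
  by rewrite /= tensor_lactE !trace_counitE /= trace_lact lactM.
by rewrite lact_linear !trace_counit_linear IHt IHu lact_linear.
Qed.

(** A triangle identity of that adjunction: on n (x) v it is the expansion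
    n = sum_i x_i io(E(y_i n)), whose coefficients move across the tensor sign. *)
Lemma trace_counitK (t : tensor_bimodule N Y) :
  \sum_i pure (x i : N) (trace_counit (lact (y i) t)) = t.
Proof.
pose f (t : tensor_bimodule N Y) : tensor_bimodule N Y :=
  \sum_i pure (x i : N) (trace_counit (lact (y i) t)).
have fl : linear f.
  move=> c u v; rewrite /f scaler_sumr -big_split; apply: eq_bigr => i _ /=.
  by rewrite tensor_lact_linear trace_counit_linear pure_linearr.
(* The linearity of f reduces the identity to pure tensors. *)
rewrite -/(f t); elim/tensor_ind: t => [n v|c t u IHt IHu]; last first.
  by rewrite fl IHt IHu.
rewrite /f -[in RHS](dual_lP F n) pure_suml; apply: eq_bigr => i _.
by rewrite /= tensor_lactE trace_counitE -pure_balanced.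
Qed.

End TraceCounit.

Section ActionCounit.

Variable X : lmodule S.

(** The canonical isomorphism of M (x)_S X with X, of which v |-> 1 (x) v is the
    inverse ([action_counitK]). *)
Definition action_counit : tensor_bimodule M X -> X :=
  tensor_lift (fun (m : M) v => lact (m : S) v).

Lemma action_counit_linear : linear action_counit.
Proof. exact: tensor_lift_linear. Qed.

Lemma action_counitE (m : M) v : action_counit (pure m v) = lact (m : S) v.
Proof.
apply: tensor_liftE => [u c s t|s|s a u].
- by rewrite lact_linearl.
- exact: lact_linear.
- by rewrite /= lactM.
Qed.

Lemma action_counit_lact a t :
  action_counit (lact a t) = lact (io a) (action_counit t).
Proof.
elim/tensor_ind: t => [m v|c t u IHt IHu].
  by rewrite /= tensor_lactE !action_counitE /= lactM.
by rewrite lact_linear !action_counit_linear IHt IHu lact_linear.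
Qed.

Lemma action_counitK (t : tensor_bimodule M X) :
  pure (1 : M) (action_counit t) = t.
Proof.
elim/tensor_ind: t => [m v|c t u IHt IHu].
  by rewrite action_counitE -pure_balanced /= mul1r.
by rewrite action_counit_linear pure_linearr IHt IHu.
Qed.

End ActionCounit.

Section RestrictionInduction.

Variables (X : lmodule S) (Y : lmodule A).

Section Transpose.

Variable f : bimod_hom (tensor_bimodule M X) Y.

(** The unit v |-> sum_i x_i (x) y_i (x) v, followed by N (x) f. *)
Definition restriction_unit_fun (v : X) : tensor_bimodule N Y :=
  \sum_i pure (x i : N) (f (pure (y i : M) v)).

Lemma restriction_unit_linear : linear restriction_unit_fun.
Proof.
move=> c u v; rewrite /restriction_unit_fun scaler_sumr -big_split.
apply: eq_bigr => i _ /=.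
by rewrite (tensor_hom_linearr f) pure_linearr.
Qed.

Lemma restriction_unit_lact s v :
  restriction_unit_fun (lact s v) = lact s (restriction_unit_fun v).
Proof.
pose b (n m : S) : tensor_bimodule N Y := pure (n : N) (f (pure (m : M) v)).
have ll := @lact_linear _ _ _ (tensor_bimodule N Y) s.
rewrite /restriction_unit_fun (linear_fun_sum ll).
transitivity (\sum_i b (x i) (y i * s)).
  by apply: eq_bigr => i _; rewrite /b -pure_balanced.
rewrite casimir.
- by apply: eq_bigr => i _; rewrite /= tensor_lactE.
- by move=> t c u u'; rewrite /b pure_linearl.
- by move=> t c u u'; rewrite /b (tensor_hom_linearl f) pure_linearr.
move=> t a u; rewrite /b -induction_ractE pure_balanced -bimod_hom_lact.
by rewrite /= tensor_lactE.
Qed.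

Definition restriction_transpose : bimod_hom X (tensor_bimodule N Y) :=
  lmod_hom restriction_unit_linear restriction_unit_lact.

End Transpose.

Section Inverse.

Variable h : bimod_hom X (tensor_bimodule N Y).

Definition trace_act (m : M) (v : X) : Y := trace_counit (h (lact (m : S) v)).

Lemma trace_act_linearl v : linear (trace_act^~ v).
Proof.
by move=> c m m'; rewrite /trace_act lact_linearl bimod_hom_linear trace_counit_linear.
Qed.

Lemma trace_act_linearr m : linear (trace_act m).
Proof.
by move=> c u v; rewrite /trace_act lact_linear bimod_hom_linear trace_counit_linear.
Qed.

Lemma trace_act_balanced m s v : trace_act (ract m s) v = trace_act m (lact s v).
Proof. by rewrite /trace_act /= lactM. Qed.

Lemma trace_act_lact a m v : trace_act (lact a m) v = lact a (trace_act m v).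
Proof. by rewrite /trace_act lactM bimod_hom_lact trace_counit_lact. Qed.

Definition restriction_transpose_inv : bimod_hom (tensor_bimodule M X) Y :=
  tensor_lmod_hom trace_act_linearl trace_act_linearr
    trace_act_balanced trace_act_lact.

End Inverse.

(** One composite is the identity by sum_i io(E(x_i)) y_i = 1, the other by
    [trace_counitK]. *)
Lemma restriction_transpose_bij : bijective restriction_transpose.
Proof.
exists restriction_transpose_inv => [f|h].
  apply: eq_tensor_hom => m v.
  rewrite tensor_lmod_homE /trace_act lmod_homE /restriction_unit_fun.
  rewrite (linear_fun_sum (@trace_counit_linear _)).
  under eq_bigr => i _ do rewrite trace_counitE -bimod_hom_lact -pure_balanced.
  rewrite -(linear_fun_sum (bimod_hom_linear _)).
  under eq_bigr => i _ do rewrite /= tensor_lactE.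
  rewrite -pure_suml.
  congr (f (pure _ _)).
  (* This is [dual_rP] at s = 1, multiplied by m. *)
  under eq_bigr => i _ do rewrite restriction_lactE mulrA -[x i]mul1r.
  by rewrite -mulr_suml dual_rP mul1r.
apply: bimod_homP => v; rewrite lmod_homE /restriction_unit_fun -[RHS]trace_counitK.
apply: eq_bigr => i _; rewrite tensor_lmod_homE /trace_act.
by rewrite bimod_hom_lact.
Qed.

End RestrictionInduction.

Lemma restriction_induction_adjoint : adjoint (tensor_functor M) (tensor_functor N).
Proof.
exists restriction_transpose; split=> [X Y|X X' Y Y' u v f].
  exact: restriction_transpose_bij.
apply: bimod_homP => w; rewrite [LHS]lmod_homE !comp_lfunE.
rewrite (lmod_homE (restriction_unit_linear f)) /restriction_unit_fun.
rewrite (linear_fun_sum (bimod_hom_linear (fmap (tensor_functor N) v))).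
by apply: eq_bigr => i _; rewrite !comp_lfunE !tensor_functorE.
Qed.

Section InductionRestriction.

Variables (Y : lmodule A) (X : lmodule S).

Section Transpose.

Variable f : bimod_hom (tensor_bimodule N Y) X.

Definition induction_unit_fun (v : Y) : tensor_bimodule M X :=
  pure (1 : M) (f (pure (1 : N) v)).

Lemma induction_unit_linear : linear induction_unit_fun.
Proof.
move=> c u v.
by rewrite /induction_unit_fun pure_linearr bimod_hom_linear pure_linearr.
Qed.

Lemma induction_unit_lact a v :
  induction_unit_fun (lact a v) = lact a (induction_unit_fun v).
Proof.
have aE : pure (1 : N) (lact a v) = lact (io a) (pure (1 : N) v : tensor_bimodule N Y).
  by rewrite -pure_balanced /= tensor_lactE /= mul1r mulr1.
rewrite /induction_unit_fun aE bimod_hom_lact -pure_balanced.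
by rewrite /= tensor_lactE /= mul1r mulr1.
Qed.

Definition induction_transpose : bimod_hom Y (tensor_bimodule M X) :=
  lmod_hom induction_unit_linear induction_unit_lact.

End Transpose.

Section Inverse.

Variable h : bimod_hom Y (tensor_bimodule M X).

Definition induced_act (n : N) (v : Y) : X := lact (n : S) (action_counit (h v)).

Lemma induced_act_linearl v : linear (induced_act^~ v).
Proof. exact: lact_linearl. Qed.

Lemma induced_act_linearr n : linear (induced_act n).
Proof.
by move=> c u v; rewrite /induced_act bimod_hom_linear action_counit_linear lact_linear.
Qed.

Lemma induced_act_balanced n a v : induced_act (ract n a) v = induced_act n (lact a v).
Proof. by rewrite /induced_act (bimod_hom_lact h) action_counit_lact /= lactM. Qed.

Lemma induced_act_lact s n v : induced_act (lact s n) v = lact s (induced_act n v).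
Proof. by rewrite /induced_act /= lactM. Qed.

Definition induction_transpose_inv : bimod_hom (tensor_bimodule N Y) X :=
  tensor_lmod_hom induced_act_linearl induced_act_linearr
    induced_act_balanced induced_act_lact.

End Inverse.

Lemma induction_transpose_bij : bijective induction_transpose.
Proof.
exists induction_transpose_inv => [f|h].
  apply: eq_tensor_hom => n v.
  rewrite tensor_lmod_homE /induced_act lmod_homE /induction_unit_fun.
  rewrite action_counitE lact1.
  by rewrite -bimod_hom_lact /= tensor_lactE /= mulr1.
apply: bimod_homP => v; rewrite lmod_homE /induction_unit_fun.
rewrite tensor_lmod_homE /induced_act lact1; exact: action_counitK.
Qed.

End InductionRestriction.

Lemma induction_restriction_adjoint : adjoint (tensor_functor N) (tensor_functor M).
Proof.
exists induction_transpose; split=> [Y X|Y Y' X X' u v f].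
  exact: induction_transpose_bij.
apply: bimod_homP => w; rewrite [LHS]lmod_homE !comp_lfunE.
rewrite (lmod_homE (induction_unit_linear f)).
by rewrite /induction_unit_fun !comp_lfunE !tensor_functorE.
Qed.

(** The first condition on E says that the extension splits.  The second makes
    c^-1 sum_i x_i (x) y_i a separability idempotent. *)
Theorem split_separable_frobenius_equivalent (c : k) :
    (forall a, E (io a) = a) -> c != 0 -> \sum_i x i * y i = c *: 1 ->
  symmetrically_separably_equivalent A S.
Proof.
move=> EioK c0 xyE; exists M, N; split.
- exact: restriction_projective.
- exact: induction_projective.
- exact: restriction_induction_summand.
- exact: induction_restriction_summand c0 xyE.
split; [exact: restriction_induction_adjoint | exact: induction_restriction_adjoint].
Qed.

End Frobenius.

(** * The skew group algebra *)

Section Skew.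

Variables (k : fieldType) (gT : finGroupType) (A : falgType k).
Variable alpha : alg_action gT A.

Local Notation S := (skew_group_alg alpha).
Local Notation st := (skew_tens alpha).

Lemma skew_tensE a g h : st a g h = if h == g then a else 0.
Proof. by rewrite ffunE. Qed.

Lemma skew_tens_mull a g (s : S) h : (st a g * s) h = a * alpha g (s (g^-1 * h)%g).
Proof.
rewrite [LHS]skew_mulE (bigD1 g) //= big1 ?addr0 => [|h' /negbTE hg].
  by rewrite skew_tensE eqxx.
by rewrite skew_tensE hg mul0r.
Qed.

Lemma skew_tens_mulr (s : S) a g h :
  (s * st a g) h = s (h * g^-1)%g * alpha (h * g^-1)%g a.
Proof.
rewrite [LHS]skew_mulE (bigD1 (h * g^-1)%g) //= big1 ?addr0 => [|h' /negbTE hg].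
  by rewrite skew_tensE invMg invgK mulgKV eqxx.
rewrite skew_tensE; case: eqP => [hE|_]; last by rewrite linear0 mulr0.
by move: hg; rewrite -hE invMg invgK mulKVg eqxx.
Qed.

Lemma skew_sum (s : S) : \sum_g st (s g) g = s.
Proof.
apply/ffunP => h; rewrite sum_ffunE (bigD1 h) //= big1 ?addr0.
  by rewrite skew_tensE eqxx.
by move=> g /negbTE gh; rewrite skew_tensE eq_sym gh.
Qed.

Definition skew_incl (a : A) : S := st a 1%g.

Lemma skew_incl_linear : linear skew_incl.
Proof.
move=> c a b; apply/ffunP => h; rewrite !ffunE.
by case: eqP => // _; rewrite scaler0 addr0.
Qed.

Lemma skew_incl_monoid : monoid_morphism skew_incl.
Proof. by split=> // a b; rewrite /skew_incl skew_tensM alg_act1 mulg1. Qed.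

HB.instance Definition _ := GRing.isLinear.Build k A S *:%R skew_incl skew_incl_linear.
HB.instance Definition _ := GRing.isMonoidMorphism.Build A S skew_incl skew_incl_monoid.

Definition skew_trace (s : S) : A := s 1%g.

Lemma skew_trace_linear : linear skew_trace.
Proof. by move=> c s t; rewrite /skew_trace !ffunE. Qed.

HB.instance Definition _ := GRing.isLinear.Build k S A *:%R skew_trace skew_trace_linear.

Lemma skew_trace_incll a s : skew_trace (skew_incl a * s) = a * skew_trace s.
Proof. by rewrite /skew_trace skew_tens_mull invg1 mulg1 alg_act1. Qed.

Lemma skew_trace_inclr s a : skew_trace (s * skew_incl a) = skew_trace s * a.
Proof. by rewrite /skew_trace skew_tens_mulr invg1 mulg1 alg_act1. Qed.

Lemma skew_dual_l (s : S) :
  \sum_g st 1 g * skew_incl (skew_trace (st 1 g^-1%g * s)) = s.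
Proof.
rewrite -[RHS]skew_sum; apply: eq_bigr => g _.
rewrite /skew_trace skew_tens_mull mul1r invgK mulg1 skew_tensM mul1r mulg1.
by rewrite -alg_actM mulgV alg_act1.
Qed.

Lemma skew_dual_r (s : S) :
  \sum_g skew_incl (skew_trace (s * st 1 g)) * st 1 g^-1%g = s.
Proof.
rewrite -[RHS]skew_sum [RHS](reindex_inj invg_inj); apply: eq_bigr => g _.
by rewrite /skew_trace skew_tens_mulr mul1g rmorph1 mulr1 skew_tensM alg_act1 mulr1 mul1g.
Qed.

(** Both dual basis identities are the expansion of s in the basis of group
    elements, the second one indexed by inverses: E(g^-1 s) is g^-1 applied to
    the coefficient of s at g, and E(s g) is the coefficient of s at g^-1. *)
Definition skew_frobenius : frobenius_extension A S gT :=
  FrobeniusExtension skew_trace_incll skew_trace_inclr skew_dual_l skew_dual_r.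

Lemma skew_traceK a : skew_trace (skew_incl a) = a.
Proof. by rewrite /skew_trace /skew_incl skew_tensE eqxx. Qed.

Lemma skew_casimir : \sum_g st 1 g * st 1 g^-1%g = #|gT|%:R *: (1 : S).
Proof.
rewrite scaler_nat -sumr_const; apply: eq_bigr => g _.
by rewrite skew_tensM rmorph1 mulr1 mulgV.
Qed.

End Skew.

Theorem theorem14 (k : fieldType) (A : falgType k) (gT : finGroupType)
    (alpha : alg_action gT A)
    (char_ndvd : forall p : nat, p \in [pchar k] -> ~~ (p %| #|gT|)%N) :
  symmetrically_separably_equivalent A (skew_group_alg alpha).
Proof.
apply: (@split_separable_frobenius_equivalent _ _ _ _
  (skew_frobenius alpha) #|gT|%:R).
- exact: skew_traceK.
- apply/negP => n0; have [|p pk] := natf0_pchar _ n0; first by rewrite -cardsT cardG_gt0.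
  by have := char_ndvd p pk; rewrite (dvdn_pcharf pk) n0.
exact: skew_casimir.
Qed.
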